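(* Let \[\mathcal M':=\bigcup_{(k_1,k_2,k_3)\in\mathbb Z_{\ge0}^3}\mathcal M_{k_1,k_2,k_3}\] and let $c_F:=\dfrac{2221564096+283748\sqrt{462}}{491993569}\approx 4.5278295661$ (Freiman's constant). Then \[\mathcal M'\cap[3,c_F)=\big(\mathcal M_{0,0,1}\setminus\{\sqrt5\}\big)\cup\{2\sqrt5\}.\]
   Context: For $(k_1,k_2,k_3)\in\mathbb Z_{\ge0}^3$, the $(k_1,k_2,k_3)$-generalized Markov equation is $x_1^2+x_2^2+x_3^2+k_1x_2x_3+k_2x_3x_1+k_3x_1x_2=(3+k_1+k_2+k_3)x_1x_2x_3$. For $n\in\mathbb Z_{\ge1}$ and $i\in\{1,2,3\}$ put $\Delta(n,i):=((3+k_1+k_2+k_3)n-k_i)^2-4$ (this depends on $(k_1,k_2,k_3)$). The $(k_1,k_2,k_3)$-generalized discrete Markov spectrum is \[\mathcal M_{k_1,k_2,k_3}:=\left\{\frac{\sqrt{\Delta(x_i,i)}}{x_i}\ \middle|\ (x_1,x_2,x_3)\in\mathbb Z_{>0}^3 \text{ solves the }(k_1,k_2,k_3)\text{-generalized Markov equation},\ i\in\{1,2,3\}\right\}.\] *)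

(* Defs.v *)
From mathcomp Require Import all_boot all_order all_algebra.
From mathcomp Require Import classical_sets set_interval reals.


Import Order.TTheory GRing.Theory Num.Theory.

Local Open Scope classical_set_scope.
Local Open Scope ring_scope.

(* The coordinates 1, 2, 3 of a triple are indexed by 0, 1, 2 : 'I_3. *)
Definition coord3 (a1 a2 a3 : nat) (i : 'I_3) : nat := nth 0%N [:: a1; a2; a3] i.

Definition gen_markov_eq (k1 k2 k3 x1 x2 x3 : nat) : Prop :=
  (x1 ^ 2 + x2 ^ 2 + x3 ^ 2 + k1 * x2 * x3 + k2 * x3 * x1 + k3 * x1 * x2 =
   (3 + k1 + k2 + k3) * x1 * x2 * x3)%N.

Definition Delta (k1 k2 k3 n : nat) (i : 'I_3) : int :=
  (((3 + k1 + k2 + k3) * n)%N%:Z - (coord3 k1 k2 k3 i)%:Z) ^+ 2 - 4.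

Definition gen_markov_spectrum (R : realType) (k1 k2 k3 : nat) : set R :=
  [set r | exists (x1 x2 x3 : nat) (i : 'I_3),
     [/\ (0 < x1)%N, (0 < x2)%N, (0 < x3)%N,
         gen_markov_eq k1 k2 k3 x1 x2 x3
       & let xi := coord3 x1 x2 x3 i in
         r = Num.sqrt (Delta k1 k2 k3 xi i)%:~R / xi%:R]].

Definition gen_markov_union (R : realType) : set R :=
  \bigcup_k1 \bigcup_k2 \bigcup_k3 gen_markov_spectrum R k1 k2 k3.

(* (2221564096 + 283748 * sqrt 462) / 491993569, with the large numerals written
   in base 1000 because ring literals elaborate to unary numbers. *)
Definition freiman_constant (R : realType) : R :=
  ((2 * 1000 ^+ 3 + 221 * 1000 ^+ 2 + 564 * 1000 + 96)
   + (283 * 1000 + 748) * Num.sqrt 462)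
  / (491 * 1000 ^+ 2 + 993 * 1000 + 569).

(* Main.v *)
Require Import Defs.
From mathcomp Require Import all_boot all_order all_algebra.
From mathcomp Require Import classical_sets set_interval reals.
From mathcomp Require Import zify ring lra.

(** Write [K = k1 + k2 + k3].  The element of the spectrum attached to a
    coordinate [n] with parameter [k <= K] has square
    [(3 + K - k / n)^2 - 4 / n^2].  Since [20 < c_F^2 < 21], only finitely many
    triples [(K, k, n)] with [K <> 1] give a square in [[9, c_F^2)] and a value
    other than [sqrt 12], which lies in [M_{0,0,1}] anyway.  Congruences rule out
    all of them except [(2, 2, 4)], which is realised by the solution [(1, 1, 4)]
    for the parameters [(0, 0, 2)] and gives [2 * sqrt 5].  For [K = 1] the
    spectrum is that of [(0, 0, 1)] up to permuting coordinates, and all its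
    elements but [sqrt 5] lie in [[3, 4)]. *)

Import Order.TTheory GRing.Theory Num.Theory.

Local Open Scope classical_set_scope.
Local Open Scope ring_scope.

(** * Congruence obstructions *)

(** Modulo 4 both unknowns are even; halving them leaves [u^2 + v^2 + 1 = 8uv], which fails modulo
    4. *)
Lemma no_solution_k002_n2 (x y : nat) :
  (x * x + y * y + 4 = 8 * (x * y))%N -> False.
Proof.
move=> e.
have [a [r [hr xE]]] : exists a r, (r < 4)%N /\ x = (4 * a + r)%N.
  by exists (x %/ 4)%N, (x %% 4)%N; lia.
have [b [s [hs yE]]] : exists b s, (s < 4)%N /\ y = (4 * b + s)%N.
  by exists (y %/ 4)%N, (y %% 4)%N; lia.
subst x y.
case: r hr e => [|[|[|[|//]]]] _; case: s hs => [|[|[|[|//]]]] _; lia.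
Qed.

(** As [x^2 + y^2 - 13xy = (x + y)^2 - 15xy], 3 divides [x + y]; modulo 9 it then divides [xy],
    hence [x] and [y]. Their thirds satisfy [(u + v)^2 = -1] modulo 3, which is impossible. *)
Lemma no_solution_k002_n3 (x y : nat) :
  (x * x + y * y + 9 = 13 * (x * y))%N -> False.
Proof.
move=> e.
have [a [r [hr xE]]] : exists a r, (r < 9)%N /\ x = (9 * a + r)%N.
  by exists (x %/ 9)%N, (x %% 9)%N; lia.
have [b [s [hs yE]]] : exists b s, (s < 9)%N /\ y = (9 * b + s)%N.
  by exists (y %/ 9)%N, (y %% 9)%N; lia.
subst x y.
case: r hr e => [|[|[|[|[|[|[|[|[|//]]]]]]]]] _;
  case: s hs => [|[|[|[|[|[|[|[|[|//]]]]]]]]] _; lia.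
Qed.

(** Modulo 9 this reads [y^2 + (z + 1)^2 = -3]. Modulo 3 both squares must vanish, so their sum is 0
    modulo 9. *)
Lemma no_solution_k011_n2 (y z : nat) :
  (y * y + z * z + 2 * z + 4 = 9 * (y * z))%N -> False.
Proof.
move=> e.
have [a [r [hr xE]]] : exists a r, (r < 9)%N /\ y = (9 * a + r)%N.
  by exists (y %/ 9)%N, (y %% 9)%N; lia.
have [b [s [hs yE]]] : exists b s, (s < 9)%N /\ z = (9 * b + s)%N.
  by exists (z %/ 9)%N, (z %% 9)%N; lia.
subst y z.
case: r hr e => [|[|[|[|[|[|[|[|[|//]]]]]]]]] _;
  case: s hs => [|[|[|[|[|[|[|[|[|//]]]]]]]]] _; lia.
Qed.

(** Modulo 7 this reads [(x - y)^2 = 3], and 3 is not a square there. *)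
Lemma no_solution_k003_n2 (x y : nat) :
  (x * x + y * y + 4 = 9 * (x * y))%N -> False.
Proof.
move=> e.
have [a [r [hr xE]]] : exists a r, (r < 7)%N /\ x = (7 * a + r)%N.
  by exists (x %/ 7)%N, (x %% 7)%N; lia.
have [b [s [hs yE]]] : exists b s, (s < 7)%N /\ y = (7 * b + s)%N.
  by exists (y %/ 7)%N, (y %% 7)%N; lia.
subst x y.
case: r hr e => [|[|[|[|[|[|[|//]]]]]]] _;
  case: s hs => [|[|[|[|[|[|[|//]]]]]]] _; lia.
Qed.

(** * Bounds on the parameters *)

Lemma gen_markov_parameters (K k n : nat) :
  (0 < n)%N -> (k <= K)%N ->
  (9 * n%:Z ^+ 2 <= (((3 + K) * n)%N%:Z - k%:Z) ^+ 2 - 4) ->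
  ((((3 + K) * n)%N%:Z - k%:Z) ^+ 2 - 4 < 21 * n%:Z ^+ 2) ->
  K = 1%N \/ (n = 1%N /\ K = k.+1) \/
  (K = 2%N /\ k = 2%N /\ (n = 2%N \/ n = 3%N \/ n = 4%N)) \/
  (K = 2%N /\ k = 1%N /\ n = 2%N) \/ (K = 3%N /\ k = 3%N /\ n = 2%N).
Proof.
move=> n0 kK lo hi.
have [n1|n2] : n = 1%N \/ (2 <= n)%N by lia.
  subst n; right; left; split=> //.
  have [d dE] : exists d, K = (k + d)%N by exists (K - k)%N; lia.
  (* The bounds put [(3 + d)^2] in [[13, 25)]. *)
  subst K; have : d = 1%N by nia.
  lia.
(* Here [21 n^2 + 4 < 25 n^2]. *)
have lt5 : (((3 + K) * n)%N%:Z - k%:Z) < 5 * n%:Z by nia.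
(* With [k <= K], [lt5] gives [K (n - 1) < 2 n]. *)
have K3 : (K <= 3)%N by nia.
case: K kK lo hi lt5 K3 => [|[|[|[|//]]]] kK lo hi lt5 _.
(* The classical Markov case: [9 n^2 - 4] stays below [9 n^2]. *)
- have k0 : k = 0%N by lia.
  by subst k; nia.
- by left.
(* [k = 0] contradicts [lt5]; for [k = 1] and [k = 2], [hi] becomes [4 n^2 - 10 n - 3 < 0] and
   [4 n^2 - 20 n < 0]. *)
- case: k kK lo hi lt5 => [|[|[|//]]] _ lo hi lt5; first lia.
    have : (n <= 2)%N by nia.
    by lia.
  have : (n <= 4)%N by nia.
  by lia.
- have : (n < k)%N by lia.
  by lia.
Qed.

Lemma gen_markov_solutions (a b c x y z : nat) :
  (0 < z)%N -> gen_markov_eq a b c x y z ->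
  (9 * z%:Z ^+ 2 <= (((3 + a + b + c) * z)%N%:Z - c%:Z) ^+ 2 - 4) ->
  ((((3 + a + b + c) * z)%N%:Z - c%:Z) ^+ 2 - 4 < 21 * z%:Z ^+ 2) ->
  [\/ (a + b + c = 1)%N, z = 1%N /\ (a + b = 1)%N
    | [/\ a = 0%N, b = 0%N, c = 2%N & z = 4%N]].
Proof.
rewrite -(addnA 3%N) -(addnA 3%N) => z0 e lo hi.
have cK : (c <= a + b + c)%N by lia.
have := gen_markov_parameters _ _ _ z0 cK lo hi.
rewrite /gen_markov_eq !expnS !expn0 !muln1 in e.
case=> [->|]; first by constructor 1.
case=> [[-> h]|]; first by constructor 2; split=> //; lia.
case=> [[h [cE zE]]|].
  have a0 : a = 0%N by lia.
  have b0 : b = 0%N by lia.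
  subst a b c.
  case: zE => [zE|[zE|->]]; last by constructor 3.
  - by subst z; case: (no_solution_k002_n2 x y); lia.
  - by subst z; case: (no_solution_k002_n3 x y); lia.
case=> [[h [cE zE]]|[h [cE zE]]]; subst c z.
  have [[a0 b0]|[a0 b0]] : a = 1%N /\ b = 0%N \/ a = 0%N /\ b = 1%N by lia.
  - by subst a b; case: (no_solution_k011_n2 x y); lia.
  - by subst a b; case: (no_solution_k011_n2 y x); lia.
have a0 : a = 0%N by lia.
have b0 : b = 0%N by lia.
by subst a b; case: (no_solution_k003_n2 x y); lia.
Qed.

(** * Cyclic symmetry of the spectrum *)

Lemma gen_markov_eq_rot (k1 k2 k3 x1 x2 x3 : nat) :
  gen_markov_eq k1 k2 k3 x1 x2 x3 -> gen_markov_eq k2 k3 k1 x2 x3 x1.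
Proof. by rewrite /gen_markov_eq !expnS !expn0 !muln1 => e; lia. Qed.

Lemma gen_markov_spectrum_rot_sub (R : realType) (k1 k2 k3 : nat) :
  gen_markov_spectrum R k1 k2 k3 `<=` gen_markov_spectrum R k2 k3 k1.
Proof.
move=> r [x1 [x2 [x3 [i [p1 p2 p3 /gen_markov_eq_rot e rE]]]]].
exists x2, x3, x1.
have sE : (3 + k2 + k3 + k1 = 3 + k1 + k2 + k3)%N by lia.
case: i rE => -[|[|[|//]]] hi rE;
  [exists (inord 2)|exists (inord 0)|exists (inord 1)];
  split=> //=; rewrite rE /Delta /coord3 inordK //= sE //.
Qed.

Lemma gen_markov_spectrum_rot (R : realType) (k1 k2 k3 : nat) :
  gen_markov_spectrum R k1 k2 k3 = gen_markov_spectrum R k2 k3 k1.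
Proof.
apply/seteqP; split; first exact: gen_markov_spectrum_rot_sub.
(* Two more rotations close the 3-cycle. *)
by move=> r /gen_markov_spectrum_rot_sub /gen_markov_spectrum_rot_sub.
Qed.

(** [S] stands for [3 + k1 + k2 + k3], [n] for the chosen coordinate and [k] for its parameter. *)
Definition spectrum_value (R : realType) (S k n : nat) : R :=
  Num.sqrt (((S * n)%N%:Z - k%:Z) ^+ 2 - 4)%:~R / n%:R.

(** Rotating the chosen coordinate into third place makes [gen_markov_solutions] applicable. *)
Lemma gen_markov_spectrum_third (R : realType) (k1 k2 k3 : nat) (r : R) :
  gen_markov_spectrum R k1 k2 k3 r ->
  exists a b c x y z : nat,
    [/\ (0 < z)%N, gen_markov_eq a b c x y z,
        r = spectrum_value R (3 + a + b + c) c z &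
        gen_markov_spectrum R a b c = gen_markov_spectrum R k1 k2 k3].
Proof.
move=> [x1 [x2 [x3 [i [p1 p2 p3 e rE]]]]].
have rot := gen_markov_spectrum_rot R.
case: i rE => -[|[|[|//]]] hi rE.
- exists k2, k3, k1, x2, x3, x1; split=> //; first exact: gen_markov_eq_rot.
    rewrite rE /spectrum_value /Delta /coord3 /=.
    by have -> : (3 + k2 + k3 + k1 = 3 + k1 + k2 + k3)%N by lia.
- exists k3, k1, k2, x3, x1, x2; split=> //.
  + by do 2 apply: gen_markov_eq_rot.
  + rewrite rE /spectrum_value /Delta /coord3 /=.
    by have -> : (3 + k3 + k1 + k2 = 3 + k1 + k2 + k3)%N by lia.
- by exists k1, k2, k3, x1, x2, x3.
Qed.

(** * Comparison with 3 and Freiman's constant *)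

Lemma ler_sqrt_div (R : realType) (c d n : R) :
  0 < c -> 0 < n -> (c <= Num.sqrt d / n) = (c ^+ 2 * n ^+ 2 <= d).
Proof.
move=> c0 n0; rewrite ler_pdivlMr // -exprMn.
have cn : 0 < c * n by rewrite mulr_gt0.
(* For [d < 0] the root is 0 by convention, and both sides are false. *)
have [d0|d0] := ltP d 0.
  rewrite ltr0_sqrtr // leNgt cn; apply/esym/negbTE; rewrite -ltNge.
  by rewrite (lt_le_trans d0) // sqr_ge0.
by rewrite -{1}(ger0_norm (ltW cn)) -sqrtr_sqr ler_sqrt.
Qed.

Lemma ltr_sqrt_div (R : realType) (c d n : R) :
  0 < c -> 0 < n -> (Num.sqrt d / n < c) = (d < c ^+ 2 * n ^+ 2).
Proof. by move=> c0 n0; rewrite ltNge ler_sqrt_div// -ltNge. Qed.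

(** Precise enough to place the square between 20 and 21: the bounds square to 20.25 and 20.7025. *)
Lemma freiman_constant_bounds (R : realType) :
  9 / 2 < freiman_constant R < 91 / 20.
Proof.
have lo : 21 <= Num.sqrt 462 :> R.
  by rewrite -(ger0_norm (ler0n R 21)) -sqrtr_sqr ler_sqrt; lra.
have hi : Num.sqrt 462 <= 22 :> R.
  by rewrite -(ger0_norm (ler0n R 22)) -sqrtr_sqr ler_sqrt; lra.
rewrite /freiman_constant; have dp : 0 < 491 * 1000 ^+ 2 + 993 * 1000 + 569 :> R.
  by lra.
rewrite ltr_pdivlMr // ltr_pdivrMr //; apply/andP; split; lra.
Qed.

Lemma spectrum_value_ge3 (R : realType) (S k n : nat) : (0 < n)%N ->
  (3 <= spectrum_value R S k n) =
  (9 * n%:Z ^+ 2 <= ((S * n)%N%:Z - k%:Z) ^+ 2 - 4).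
Proof.
move=> n0; rewrite ler_sqrt_div ?ltr0n// -(ler_int R).
by congr (_ <= _); rewrite rmorphM rmorphXn/=; ring.
Qed.

Lemma spectrum_value_lt_freiman (R : realType) (S k n : nat) : (0 < n)%N ->
  spectrum_value R S k n < freiman_constant R ->
  ((S * n)%N%:Z - k%:Z) ^+ 2 - 4 < 21 * n%:Z ^+ 2.
Proof.
move=> n0 h; have /andP[_ cF] := freiman_constant_bounds R.
have := lt_trans h cF; rewrite ltr_sqrt_div ?ltr0n//; last lra.
move=> {}h; rewrite -(ltr_int R) (lt_le_trans h) //.
rewrite rmorphM rmorphXn /= ler_wpM2r ?sqr_ge0 //; lra.
Qed.

Lemma spectrum_value_lt_freiman_of_le (R : realType) (S k n : nat) : (0 < n)%N ->
  ((S * n)%N%:Z - k%:Z) ^+ 2 - 4 <= 20 * n%:Z ^+ 2 ->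
  spectrum_value R S k n < freiman_constant R.
Proof.
move=> n0; have /andP[cF _] := freiman_constant_bounds R.
rewrite -(ler_int R) intrM rmorphXn /= => h.
apply: lt_trans cF; rewrite ltr_sqrt_div ?ltr0n//; last lra.
apply: le_lt_trans h _; rewrite ltr_pM2r ?exprn_gt0 ?ltr0n //; lra.
Qed.

(** * Values attained in the interval *)

Lemma spectrum_value_k002_n4 (R : realType) :
  spectrum_value R 5 2 4 = 2 * Num.sqrt 5.
Proof.
rewrite /spectrum_value.
have -> : ((((5 * 4)%N%:Z - 2%:Z) ^+ 2 - 4)%:~R : R) = 8 ^+ 2 * 5.
  have -> : ((5 * 4)%N%:Z - 2%:Z) ^+ 2 - 4 = 8 ^+ 2 * 5 :> int by lia.
  by rewrite rmorphM rmorphXn.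
rewrite sqrtrM ?sqr_ge0 // sqrtr_sqr ger0_norm ?ler0n //.
by field.
Qed.

Lemma two_sqrt5_in_union (R : realType) : gen_markov_union R (2 * Num.sqrt 5).
Proof.
exists 0%N => //; exists 0%N => //; exists 2%N => //.
exists 1%N, 1%N, 4%N, (inord 2); split=> //.
by rewrite -spectrum_value_k002_n4 /spectrum_value /Delta /coord3 inordK.
Qed.

Lemma gen_markov_spectrum_sum1 (R : realType) (a b c : nat) :
  (a + b + c = 1)%N -> gen_markov_spectrum R a b c = gen_markov_spectrum R 0 0 1.
Proof.
move=> h.
have [[-> [-> ->]]|[[-> [-> ->]]|[-> [-> ->]]]] :
    (a = 0 /\ b = 0 /\ c = 1 \/ a = 0 /\ b = 1 /\ c = 0 \/
     a = 1 /\ b = 0 /\ c = 0)%N by lia.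
- by [].
- by rewrite -gen_markov_spectrum_rot.
- by rewrite gen_markov_spectrum_rot.
Qed.

(** Since [c] cancels, the value is always [sqrt 12], attained at the first coordinate of the
    solution [(1, 1, 1)]. *)
Lemma spectrum_value_n1_in_k001 (R : realType) (a b c : nat) :
  (a + b = 1)%N ->
  gen_markov_spectrum R 0 0 1 (spectrum_value R (3 + a + b + c) c 1).
Proof.
move=> h; exists 1%N, 1%N, 1%N, (inord 0); split=> //=.
rewrite /spectrum_value /Delta /coord3 inordK //=.
by congr (Num.sqrt _%:~R / _); lia.
Qed.

Lemma spectrum_k001_bounds (R : realType) (r : R) :
  gen_markov_spectrum R 0 0 1 r -> r <> Num.sqrt 5 ->
  3 <= r < freiman_constant R.
Proof.
move=> [x1 [x2 [x3 [i [p1 p2 p3 _]]]]].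
have -> : (let xi := coord3 x1 x2 x3 i in
    r = Num.sqrt (Delta 0 0 1 xi i)%:~R / xi%:R) =
    (r = spectrum_value R 4 (coord3 0 0 1 i) (coord3 x1 x2 x3 i)) by [].
have : (0 < coord3 x1 x2 x3 i)%N by case: i => -[|[|[|]]].
have : (coord3 0 0 1 i <= 1)%N by case: i => -[|[|[|]]].
move: (coord3 0 0 1 i) (coord3 x1 x2 x3 i) => k n k1 n0 -> rN.
(* The excluded pair [k = n = 1] gives exactly [sqrt 5]; every other pair satisfies
   [9 n^2 <= (4 n - k)^2 - 4]. *)
have kn : k = 0%N \/ (2 <= n)%N.
  have [kn|[kE nE]] : (k = 0%N \/ (2 <= n)%N) \/ (k = 1%N /\ n = 1%N) by lia.
    by [].
  by case: rN; rewrite kE nE /spectrum_value divr1.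
apply/andP; split.
  by rewrite spectrum_value_ge3 //; nia.
by apply: spectrum_value_lt_freiman_of_le => //; nia.
Qed.

Theorem theorem6p10 (R : realType) :
  gen_markov_union R `&` `[3, freiman_constant R[%classic =
  (gen_markov_spectrum R 0 0 1 `\ Num.sqrt 5) `|` [set 2 * Num.sqrt 5].
Proof.
(* Hence no element of the interval is the removed point. *)
have sqrt5_lt3 : Num.sqrt 5 < 3 :> R.
  by rewrite -(divr1 (Num.sqrt 5)) ltr_sqrt_div //; lra.
apply/seteqP; split=> r /=.
  move=> [[k1 _ [k2 _ [k3 _ hr]]]]; rewrite in_itv /= => /andP[r3 rF].
  have [a [b [c [x [y [z [z0 e rE sE]]]]]]] := gen_markov_spectrum_third R _ _ _ _ hr.
  have rN5 : r <> Num.sqrt 5 by move=> rE5; move: r3; rewrite rE5 leNgt sqrt5_lt3.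
  rewrite -{}sE in hr; move: r3 rF; rewrite {1 2}rE => r3 rF.
  rewrite spectrum_value_ge3 // in r3.
  have {}rF := spectrum_value_lt_freiman _ _ _ _ z0 rF.
  case: (gen_markov_solutions _ _ _ _ _ _ z0 e r3 rF).
  - by move=> h; left; split=> //; rewrite -(gen_markov_spectrum_sum1 R _ _ _ h).
  - by move=> [zE ab]; left; split=> //; rewrite rE zE; exact: spectrum_value_n1_in_k001.
  - by move=> [aE bE cE zE]; right; rewrite rE aE bE cE zE spectrum_value_k002_n4.
case=> [[hr rN]|->].
  split; first by exists 0%N => //; exists 0%N => //; exists 1%N.
  by rewrite in_itv /=; exact: spectrum_k001_bounds.
split; first exact: two_sqrt5_in_union.
rewrite in_itv /= -spectrum_value_k002_n4 spectrum_value_ge3 //=.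
by apply: spectrum_value_lt_freiman_of_le.
Qed.
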